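(* Let $T\subseteq S_4$ with $|T|=4$. Suppose that $4321\notin T$, $T\neq\{1234,1432,3214,4312\}$ and $T\neq\{1234,1432,3214,4231\}$. Then $\langle S_n(T)\rangle=S_n$.
   Context: $S_n$ is the symmetric group on $[n]$, permutations in one-line notation. A permutation $\pi\in S_n$ contains the pattern $\tau\in S_k$ if some subsequence of $\pi$ of length $k$ is order-isomorphic to $\tau$; otherwise it avoids $\tau$. $S_n(T)$ is the set of permutations in $S_n$ avoiding every pattern in $T$, and $\langle S_n(T)\rangle$ is the subgroup of $S_n$ it generates.
   Formalization: The formal theorem also assumes T≠{1234,1432,3214,3421}, the inverse of the excluded set {1234,1432,3214,4312}; for this T the claim fails for large even n, as every avoider is decreasing except in a bounded final segment, so the group preserves the two halves of [n]. *)

(* Defs.v *)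
From HB Require Import structures.
From mathcomp Require Import all_boot all_fingroup.
Set Implicit Arguments.
Unset Strict Implicit.
Unset Printing Implicit Defensive.

(* 'I_n is {0, ..., n-1}; words are written with the usual letters 1, ..., n. *)
Definition one_line (n : nat) (p : 'S_n) : seq nat :=
  [seq (p i).+1 | i <- enum 'I_n].

(* The permutation of [n] with one-line notation w; it is the identity when w
   is not a permutation of 1, ..., n (see perm_wordK for the meaningful case). *)
Definition perm_word (n : nat) (w : seq nat) : 'S_n :=
  odflt 1%g [pick p : 'S_n | one_line p == w].

Lemma perm_wordK (n : nat) (w : seq nat) :
  perm_eq w (iota 1 n) -> one_line (perm_word n w) = w.
Proof.
move=> pw; rewrite /perm_word; case: pickP => [p /eqP //|no].
have sw : size w = n by rewrite (perm_size pw) size_iota.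
have bw (i : 'I_n) : 0 < nth 0 w i < n.+1.
  have : nth 0 w i \in w by rewrite mem_nth // sw.
  by rewrite (perm_mem pw) mem_iota add1n.
have bf (i : 'I_n) : (nth 0 w i).-1 < n.
  by have /andP[w0] := bw i; rewrite -{1}(prednK w0) ltnS.
have inj : injective (fun i : 'I_n => Ordinal (bf i)).
  move=> i j /(congr1 val) /= eij; apply/val_inj/eqP => /=.
  rewrite -(nth_uniq 0 _ _ (s := w)) ?sw //; last first.
    by rewrite (perm_uniq pw) iota_uniq.
  have /andP[wi _] := bw i; have /andP[wj _] := bw j.
  by rewrite -(prednK wi) -(prednK wj) eij.
case/eqP: (no (perm inj)); apply: (@eq_from_nth _ 0).
  by rewrite size_map size_enum_ord sw.
move=> k; rewrite size_map size_enum_ord => kn.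
rewrite (nth_map (Ordinal kn)) ?size_enum_ord // permE /=.
rewrite nth_enum_ord //; have /andP[w0 _] := bw (Ordinal kn).
exact: prednK w0.
Qed.

(* f lists, in increasing order, the positions of a subsequence of p that is
   order-isomorphic to t. *)
Definition contains (n k : nat) (p : 'S_n) (t : 'S_k) : bool :=
  [exists f : {ffun 'I_k -> 'I_n},
    [forall i : 'I_k, forall j : 'I_k, (i < j) ==> (f i < f j)] &&
    [forall i : 'I_k, forall j : 'I_k, (t i < t j) == (p (f i) < p (f j))]].

Definition avoids (n k : nat) (p : 'S_n) (t : 'S_k) : bool := ~~ contains p t.

Definition avoiders (n k : nat) (T : {set 'S_k}) : {set 'S_n} :=
  [set p | [forall t in T, avoids p t]].

(* Main.v *)
(* Write w = n ... 2 1 and let c be the n-cycle i |-> i + 1 (mod n).  In one-line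
   notation w c = 1 n (n-1) ... 2, w c^-1 = (n-1) ... 2 1 n, c = 2 3 ... n 1 and
   c^-1 = n 1 2 ... (n-1), and each of these words, even after an exchange of
   two adjacent extreme letters, contains very few patterns of length 4.
   Since 4321 is not in T, w always avoids T.
   - If 1432 is not in T, then w c, hence c, is in the group, and one of the five
     words that yield an adjacent transposition from w, w c or w c^2 avoids T,
     as T cannot contain the five corresponding patterns.  Reversing and
     complementing gives the case of 3214.
   - If 1432 and 3214 are in T but none of 3421, 4231, 4312 is, then w s avoids T
     for every adjacent transposition s.
   - Otherwise the three exceptions show that 1234 is not in T, so that only one
     element of T is unknown: c or c^-1 avoids T, and so does one of the words
     that yield an adjacent transposition. *)

Require Import Defs.
From HB Require Import structures.
From mathcomp Require Import all_boot all_fingroup.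
From mathcomp Require Import ssralg zmodp zify.

Set Implicit Arguments.
Unset Strict Implicit.
Unset Printing Implicit Defensive.

(** * Reduction of avoidance to the list of patterns of length 4 *)

(** Standardization of four letters by ranks, built from comparisons only, so that deciding these
    yields an explicit word. *)
Definition std_word (a b c d : nat) : seq nat :=
  [:: ((b < a) + (c < a) + (d < a)).+1; ((a < b) + (c < b) + (d < b)).+1;
      ((a < c) + (b < c) + (d < c)).+1; ((a < d) + (b < d) + (c < d)).+1].

Lemma sum_ltn_ord (n k : nat) : k <= n -> \sum_(i < n) (i < k) = k.
Proof.
move=> kn; rewrite -(big_mkord xpredT (fun i => (i < k) : nat)).
rewrite (@big_cat_nat _ _ _ k) //= [X in _ + X]big1_seq ?addn0; last first.
  by move=> i /andP[_]; rewrite mem_index_iota leqNgt => /andP[/negPf ->].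
rewrite (eq_big_nat _ _ (F2 := fun=> 1)) => [|i /andP[_ ->] //].
by rewrite sum_nat_const_nat subn0 muln1.
Qed.

Lemma perm_rank (k : nat) (t : 'S_k) (i : 'I_k) :
  \sum_(j < k) (t j < t i) = t i.
Proof.
rewrite -[RHS](@sum_ltn_ord k) ?(ltnW (ltn_ord _)) //.
by rewrite [RHS](reindex_inj (@perm_inj _ t)).
Qed.

(** Each value of [t] counts the smaller values ([perm_rank]), and an occurrence in [p] has the same
    comparisons. *)
Lemma contains_std_word (n : nat) (p : 'S_n) (t : 'S_4) :
  contains p t ->
  exists x0 x1 x2 x3 : 'I_n, [/\ x0 < x1, x1 < x2, x2 < x3 &
    one_line t = std_word (p x0) (p x1) (p x2) (p x3)].
Proof.
case/existsP=> f /andP[/forallP fm /forallP fp].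
pose o i (lt_i4 : i < 4) := Ordinal lt_i4.
exists (f (o 0 isT)), (f (o 1 isT)), (f (o 2 isT)), (f (o 3 isT)).
split; try by apply: (implyP (forallP (fm _) _)).
have E i j : (p (f i) < p (f j)) = (t i < t j).
  by have /forallP/(_ j)/eqP := fp i.
rewrite /std_word !E /one_line.
have -> : enum 'I_4 = [:: o 0 isT; o 1 isT; o 2 isT; o 3 isT].
  by apply: (inj_map val_inj); rewrite val_enum_ord.
have R i : t i = (t (o 0 isT) < t i) + (t (o 1 isT) < t i) +
                 (t (o 2 isT) < t i) + (t (o 3 isT) < t i) :> nat.
  rewrite -{1}(perm_rank t) !big_ord_recl big_ord0 addn0 !addnA.
  by congr (_ + _ + _ + _); congr (nat_of_bool (nat_of_ord (t _) < _));
    apply: val_inj.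
by congr [:: _; _; _; _]; rewrite {1}R ltnn ?addn0 ?add0n.
Qed.

Definition misses (T : {set 'S_4}) (L : seq (seq nat)) : bool :=
  all (fun l => perm_word 4 l \notin T) L.

Lemma one_line_inj (n : nat) : injective (@one_line n).
Proof.
move=> p q /eq_in_map epq; apply/permP => i; apply: val_inj.
by apply: succn_inj; rewrite epq ?mem_enum.
Qed.

Lemma mem_avoiders (n : nat) (T : {set 'S_4}) (p : 'S_n) (L : seq (seq nat)) :
  (forall x0 x1 x2 x3 : 'I_n, x0 < x1 -> x1 < x2 -> x2 < x3 ->
     std_word (p x0) (p x1) (p x2) (p x3) \in L) ->
  misses T L -> p \in avoiders n T.
Proof.
move=> pL /allP LT; rewrite inE; apply/forall_inP => t tT; apply/negP.
case/contains_std_word => x0 [x1 [x2 [x3 [x01 x12 x23 et]]]].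
have /LT/negP := pL _ _ _ _ x01 x12 x23; apply; rewrite -et /perm_word.
case: pickP => [q /eqP eq|/(_ t)]; last by rewrite eqxx.
by rewrite (one_line_inj (eq : one_line q = one_line t)).
Qed.

(** * The reversal, the cycle and their words *)

Definition rev_perm (n : nat) : 'S_n := perm (@rev_ord_inj n).

(** The cycle c as addition of 1 in Z/(m+2), the form used by [gen_tpermn_circular_shift]. *)
Definition shift_perm (m : nat) : 'S_m.+2 := perm (@GRing.addrI 'I_m.+2 1%R).

Lemma val_rev_perm (n : nat) (i : 'I_n) : rev_perm n i = n - i.+1 :> nat.
Proof. by rewrite permE. Qed.

Lemma val_shift_perm (m : nat) (i : 'I_m.+2) :
  shift_perm m i = (if i == m.+1 :> nat then 0 else i.+1) :> nat.
Proof.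
rewrite permE [LHS]/= add1n; case: eqP => [->|ni]; first by rewrite modnn.
by rewrite modn_small //; have := ltn_ord i; lia.
Qed.

Lemma val_shift_permV (m : nat) (i : 'I_m.+2) :
  (shift_perm m)^-1%g i = (if i == 0 :> nat then m.+1 else i.-1) :> nat.
Proof.
rewrite -{2 3}[i](permKV (shift_perm m)) val_shift_perm.
by case: (_ =P m.+1).
Qed.

Lemma val_tperm (n : nat) (i j k : 'I_n) :
  tperm i j k =
    (if k == i :> nat then j : nat else if k == j :> nat then i : nat else k)
    :> nat.
Proof.
rewrite !val_eqE; case: tpermP => [->|->|/eqP/negPf-> /eqP/negPf->] //.
  by rewrite eqxx.
by rewrite eqxx; case: eqP => // ->.
Qed.

(* Tests nested in another test are decided first, and equality tests are split
   into three inequalities because lia is slow on many disequalities. *)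
Ltac word_cases :=
  do 4 (let x := fresh in intro x; pose proof (ltn_ord x));
  rewrite ?permM ?(val_tperm, val_rev_perm, val_shift_perm, val_shift_permV) /=;
  intros;
  repeat match goal with
  | |- context [@eq_op _ ?x ?y] =>
      lazymatch x with context [eq_op] => fail | _ => idtac end;
      let h := fresh in case: (ltngtP x y) => h; try (exfalso; lia)
  end;
  rewrite /std_word;
  repeat match goal with
  | |- context [leq (S ?x) ?y] =>
      let h := fresh in
      first [ have h : x < y by lia | have h : y < x by lia ];
      rewrite ?h ?(leq_gtF (ltnW h)); clear h
  end; by [].

(* As (s * t) x = t (s x), multiplying a word by bot_tperm on the right exchanges
   its letters 1 and 2, and on the left its first two positions; likewise for
   top_tperm and the last two letters or positions. *)
Definition bot_tperm (m : nat) : 'S_m.+2 :=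
  tperm (@Ordinal m.+2 0 isT) (@Ordinal m.+2 1 isT).

Definition top_tperm (m : nat) : 'S_m.+2 :=
  tperm (@Ordinal m.+2 m (leqnSn m.+1)) (@Ordinal m.+2 m.+1 (leqnn m.+2)).

(** Consecutive letters are neighbours in w, so a subsequence is decreasing up to one exchange of
    neighbours. *)
Lemma rev_tperm_avoider (n : nat) (T : {set 'S_4}) (i j : 'I_n) :
  j = i.+1 :> nat ->
  misses T
    [:: [:: 4; 3; 2; 1]; [:: 3; 4; 2; 1]; [:: 4; 2; 3; 1]; [:: 4; 3; 1; 2]] ->
  (rev_perm n * tperm i j)%g \in avoiders n T.
Proof. move=> ij; apply: mem_avoiders; word_cases. Qed.

Lemma rev_perm_avoider (n : nat) (T : {set 'S_4}) :
  misses T [:: [:: 4; 3; 2; 1]] ->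
  rev_perm n \in avoiders n T.
Proof. apply: mem_avoiders; word_cases. Qed.

Lemma rev_top_avoider (m : nat) (T : {set 'S_4}) :
  misses T [:: [:: 4; 3; 2; 1]; [:: 3; 4; 2; 1]] ->
  (rev_perm m.+2 * top_tperm m)%g \in avoiders m.+2 T.
Proof. apply: mem_avoiders; word_cases. Qed.

Lemma rev_bot_avoider (m : nat) (T : {set 'S_4}) :
  misses T [:: [:: 4; 3; 2; 1]; [:: 4; 3; 1; 2]] ->
  (rev_perm m.+2 * bot_tperm m)%g \in avoiders m.+2 T.
Proof. apply: mem_avoiders; word_cases. Qed.

Lemma rev_shift_avoider (m : nat) (T : {set 'S_4}) :
  misses T [:: [:: 4; 3; 2; 1]; [:: 1; 4; 3; 2]] ->
  (rev_perm m.+2 * shift_perm m)%g \in avoiders m.+2 T.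
Proof. apply: mem_avoiders; word_cases. Qed.

Lemma rev_shift_bot_avoider (m : nat) (T : {set 'S_4}) :
  misses T
    [:: [:: 4; 3; 2; 1]; [:: 1; 4; 3; 2]; [:: 2; 4; 3; 1]] ->
  (rev_perm m.+2 * shift_perm m * bot_tperm m)%g \in avoiders m.+2 T.
Proof. apply: mem_avoiders; word_cases. Qed.

Lemma bot_rev_shift_avoider (m : nat) (T : {set 'S_4}) :
  misses T
    [:: [:: 4; 3; 2; 1]; [:: 1; 4; 3; 2]; [:: 4; 1; 3; 2]] ->
  (bot_tperm m * (rev_perm m.+2 * shift_perm m))%g \in avoiders m.+2 T.
Proof. apply: mem_avoiders; word_cases. Qed.

(** The word is 1 2 n (n-1) ... 3. *)
Lemma rev_shift2_bot_avoider (m : nat) (T : {set 'S_4}) :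
  misses T
    [:: [:: 4; 3; 2; 1]; [:: 1; 4; 3; 2]; [:: 1; 2; 4; 3]] ->
  (rev_perm m.+2 * shift_perm m * shift_perm m * bot_tperm m)%g
    \in avoiders m.+2 T.
Proof. apply: mem_avoiders; word_cases. Qed.

Lemma rev_shiftV_avoider (m : nat) (T : {set 'S_4}) :
  misses T [:: [:: 4; 3; 2; 1]; [:: 3; 2; 1; 4]] ->
  (rev_perm m.+2 * (shift_perm m)^-1)%g \in avoiders m.+2 T.
Proof. apply: mem_avoiders; word_cases. Qed.

Lemma rev_shiftV_top_avoider (m : nat) (T : {set 'S_4}) :
  misses T
    [:: [:: 4; 3; 2; 1]; [:: 3; 2; 1; 4]; [:: 4; 2; 1; 3]] ->
  (rev_perm m.+2 * (shift_perm m)^-1 * top_tperm m)%g \in avoiders m.+2 T.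
Proof. apply: mem_avoiders; word_cases. Qed.

Lemma top_rev_shiftV_avoider (m : nat) (T : {set 'S_4}) :
  misses T
    [:: [:: 4; 3; 2; 1]; [:: 3; 2; 1; 4]; [:: 3; 2; 4; 1]] ->
  (top_tperm m * (rev_perm m.+2 * (shift_perm m)^-1))%g \in avoiders m.+2 T.
Proof. apply: mem_avoiders; word_cases. Qed.

(** The word is (n-2) ... 2 1 (n-1) n. *)
Lemma rev_shiftV2_top_avoider (m : nat) (T : {set 'S_4}) :
  misses T
    [:: [:: 4; 3; 2; 1]; [:: 3; 2; 1; 4]; [:: 2; 1; 3; 4]] ->
  (rev_perm m.+2 * (shift_perm m)^-1 * (shift_perm m)^-1 * top_tperm m)%g
    \in avoiders m.+2 T.
Proof. apply: mem_avoiders; word_cases. Qed.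

Lemma shift_avoider (m : nat) (T : {set 'S_4}) :
  misses T [:: [:: 1; 2; 3; 4]; [:: 2; 3; 4; 1]] ->
  shift_perm m \in avoiders m.+2 T.
Proof. apply: mem_avoiders; word_cases. Qed.

Lemma shiftV_avoider (m : nat) (T : {set 'S_4}) :
  misses T [:: [:: 1; 2; 3; 4]; [:: 4; 1; 2; 3]] ->
  (shift_perm m)^-1%g \in avoiders m.+2 T.
Proof. apply: mem_avoiders; word_cases. Qed.

Lemma top_avoider (m : nat) (T : {set 'S_4}) :
  misses T [:: [:: 1; 2; 3; 4]; [:: 1; 2; 4; 3]] ->
  top_tperm m \in avoiders m.+2 T.
Proof. apply: mem_avoiders; word_cases. Qed.

(** * Generating sets of the symmetric group *)

Lemma shift_tperm_gen (m : nat) (G : {group 'S_m.+2}) (i j : 'I_m.+2) :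
  j = i.+1 :> nat -> shift_perm m \in G -> tperm i j \in G ->
  G = [set: 'S_m.+2] :> {set 'S_m.+2}.
Proof.
move=> ji cG tG; apply/eqP; rewrite eqEsubset subsetT /=.
have ej : j = (1 + i)%R.
  rewrite -[RHS](permE (@GRing.addrI 'I_m.+2 1%R)); apply: ord_inj.
  by rewrite val_shift_perm ifF //; have := ltn_ord j; rewrite ji; lia.
have ji1 : coprime m.+2 (j - i)%R by rewrite ej GRing.addrK coprimen1.
rewrite -(gen_tpermn_circular_shift ji1) gen_subG.
by apply/subsetP => p; rewrite !inE => /orP[] /eqP->.
Qed.

Lemma adjacent_tperm_gen (m : nat) (G : {group 'S_m.+2}) :
  (forall i j : 'I_m.+2, j = i.+1 :> nat -> tperm i j \in G) ->
  G = [set: 'S_m.+2] :> {set 'S_m.+2}.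
Proof.
move=> tG; apply/eqP; rewrite eqEsubset subsetT /= -(gen_tperm ord0) gen_subG.
apply/subsetP => _ /imsetP[[k lt_km] _ ->].
(* The transposition (0 k+1) is the conjugate of (0 k) by (k k+1); this requires k to differ from 0,
   so (0 1) is treated apart. *)
elim: k lt_km => [|k IHk] lt_km.
  by rewrite [X in tperm _ X](_ : _ = ord0) ?tperm1 ?group1 //; apply: val_inj.
case: k IHk lt_km => [|k] IHk lt_km; first exact: tG.
have lt_k := ltnW lt_km; rewrite tpermC.
rewrite -(@tpermJ_tperm _ (Ordinal lt_k)) //.
by apply: groupJ; [rewrite tpermC; apply: IHk | apply: tG].
Qed.

(** * Counting words in [T], and the case analysis *)

Lemma perm_word_inj (k : nat) :
  {in [pred l | perm_eq l (iota 1 k)] &, injective (@perm_word k)}.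
Proof.
by move=> l1 l2 s1 s2 e; rewrite -(perm_wordK s1) -(perm_wordK s2) e.
Qed.

Definition S4_words (L : seq (seq nat)) : bool :=
  uniq L && all (fun l => perm_eq l (iota 1 4)) L.

Lemma card_perm_words (L : seq (seq nat)) :
  S4_words L -> #|[set p in map (perm_word 4) L]| = size L.
Proof.
case/andP=> uL /allP LS; rewrite cardsE -(size_map (perm_word 4)).
apply/card_uniqP; rewrite map_inj_in_uniq // => l1 l2 /LS s1 /LS s2.
exact: perm_word_inj.
Qed.

(** Pigeonhole: distinct words give distinct permutations. *)
Lemma exists_perm_word_notin (T : {set 'S_4}) (L : seq (seq nat)) :
  S4_words L -> #|T| < size L -> exists2 l, l \in L & perm_word 4 l \notin T.
Proof.
move=> SL ltL; apply/allPn; apply/negP => /allP LT.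
suff : size L <= #|T| by rewrite leqNgt ltL.
rewrite -card_perm_words //; apply/subset_leq_card/subsetP => p.
by rewrite inE => /mapP[l /LT lT ->].
Qed.

Lemma perm_words_eq (T : {set 'S_4}) (L : seq (seq nat)) :
  S4_words L -> all (fun l => perm_word 4 l \in T) L -> #|T| = size L ->
  T = [set p in map (perm_word 4) L].
Proof.
move=> SL /allP LT cT; apply/esym/eqP.
rewrite eqEcard card_perm_words // cT leqnn andbT.
by apply/subsetP => p; rewrite inE => /mapP[l /LT lT ->].
Qed.

(* T_neq3421 is T_neq4312 carried through p |-> p^-1, a symmetry under which
   <<avoiders n T>> is invariant; without it the claim fails for that T at
   n = 18 (all avoiders then preserve the partition {1..9}, {10..18}). *)
Theorem theorem8p3 (n : nat) (T : {set 'S_4})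
  (cardT : #|T| = 4)
  (notin4321 : perm_word 4 [:: 4; 3; 2; 1] \notin T)
  (T_neq4312 : T <> [set perm_word 4 [:: 1; 2; 3; 4]; perm_word 4 [:: 1; 4; 3; 2];
                         perm_word 4 [:: 3; 2; 1; 4]; perm_word 4 [:: 4; 3; 1; 2]])
  (T_neq3421 : T <> [set perm_word 4 [:: 1; 2; 3; 4]; perm_word 4 [:: 1; 4; 3; 2];
                         perm_word 4 [:: 3; 2; 1; 4]; perm_word 4 [:: 3; 4; 2; 1]])
  (T_neq4231 : T <> [set perm_word 4 [:: 1; 2; 3; 4]; perm_word 4 [:: 1; 4; 3; 2];
                         perm_word 4 [:: 3; 2; 1; 4]; perm_word 4 [:: 4; 2; 3; 1]]) :
  (<<avoiders n T>> = [set: 'S_n])%g.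
Proof.
(* For n at most 1 the group is trivial; the cycle requires n = m+2. *)
case: n => [|[|m]].
- by apply/setP => p; rewrite inE (_ : p = 1%g) ?group1 //; apply/permP => -[].
- apply/setP => p; rewrite inE (_ : p = 1%g) ?group1 //; apply/permP => i.
  by rewrite !ord1.
pose G := <<avoiders m.+2 T>>%G; rewrite -/(gval G).
have mG p : p \in avoiders m.+2 T -> p \in G by apply: mem_gen.
have wG : rev_perm m.+2 \in G.
  by apply/mG/rev_perm_avoider; rewrite /misses /= notin4321.
have bot_full : shift_perm m \in G -> bot_tperm m \in G ->
    G = [set: 'S_m.+2] :> {set _}.
  exact: shift_tperm_gen.
have top_full : shift_perm m \in G -> top_tperm m \in G ->
    G = [set: 'S_m.+2] :> {set _}.
  exact: shift_tperm_gen.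
have topG : perm_word 4 [:: 3; 4; 2; 1] \notin T -> top_tperm m \in G.
  move=> n3421; rewrite -(groupMl _ wG).
  by apply/mG/rev_top_avoider; rewrite /misses /= notin4321 n3421.
have botG : perm_word 4 [:: 4; 3; 1; 2] \notin T -> bot_tperm m \in G.
  move=> n4312; rewrite -(groupMl _ wG).
  by apply/mG/rev_bot_avoider; rewrite /misses /= notin4321 n4312.
have [i1432|n1432] := boolP (perm_word 4 [:: 1; 4; 3; 2] \in T); last first.
  have dG : (rev_perm m.+2 * shift_perm m)%g \in G.
    by apply/mG/rev_shift_avoider; rewrite /misses /= notin4321 n1432.
  have cG : shift_perm m \in G by rewrite -(groupMl _ wG).
  (* Five words against four elements of [T]; a missing one makes a modified w c^2, w c or w an
     avoider, and cancelling the known factor leaves a transposition. *)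
  have [|l] := @exists_perm_word_notin T [:: [:: 1; 2; 4; 3]; [:: 2; 4; 3; 1];
    [:: 4; 1; 3; 2]; [:: 3; 4; 2; 1]; [:: 4; 3; 1; 2]] isT.
    by rewrite cardT.
  rewrite !inE => /or4P[/eqP->|/eqP->|/eqP->|/orP[]/eqP->] nl.
  - apply: bot_full => //; rewrite -(groupMl _ cG) -(groupMl _ dG) mulgA.
    by apply/mG/rev_shift2_bot_avoider; rewrite /misses /= notin4321 n1432 nl.
  - apply: bot_full => //; rewrite -(groupMl _ dG).
    by apply/mG/rev_shift_bot_avoider; rewrite /misses /= notin4321 n1432 nl.
  - apply: bot_full => //; rewrite -(groupMr _ dG).
    by apply/mG/bot_rev_shift_avoider; rewrite /misses /= notin4321 n1432 nl.
  - exact/top_full/topG.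
  - exact/bot_full/botG.
have [i3214|n3214] := boolP (perm_word 4 [:: 3; 2; 1; 4] \in T); last first.
  have dG : (rev_perm m.+2 * (shift_perm m)^-1)%g \in G.
    by apply/mG/rev_shiftV_avoider; rewrite /misses /= notin4321 n3214.
  have cVG : (shift_perm m)^-1%g \in G by rewrite -(groupMl _ wG).
  have cG : shift_perm m \in G by rewrite -groupV.
  (* The reverse-complements of the previous five words. *)
  have [|l] := @exists_perm_word_notin T [:: [:: 2; 1; 3; 4]; [:: 4; 2; 1; 3];
    [:: 3; 2; 4; 1]; [:: 3; 4; 2; 1]; [:: 4; 3; 1; 2]] isT.
    by rewrite cardT.
  rewrite !inE => /or4P[/eqP->|/eqP->|/eqP->|/orP[]/eqP->] nl.
  - apply: top_full => //; rewrite -(groupMl _ cVG) -(groupMl _ dG) mulgA.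
    by apply/mG/rev_shiftV2_top_avoider; rewrite /misses /= notin4321 n3214 nl.
  - apply: top_full => //; rewrite -(groupMl _ dG).
    by apply/mG/rev_shiftV_top_avoider; rewrite /misses /= notin4321 n3214 nl.
  - apply: top_full => //; rewrite -(groupMr _ dG).
    by apply/mG/top_rev_shiftV_avoider; rewrite /misses /= notin4321 n3214 nl.
  - exact/top_full/topG.
  - exact/bot_full/botG.
have [none|] := boolP (misses T
    [:: [:: 3; 4; 2; 1]; [:: 4; 2; 3; 1]; [:: 4; 3; 1; 2]]).
  apply: adjacent_tperm_gen => i j ji; rewrite -(groupMl _ wG).
  by apply/mG/rev_tperm_avoider => //; rewrite /misses /= notin4321.
case/allPn => y yL; rewrite negbK => yT.
have n1234 : perm_word 4 [:: 1; 2; 3; 4] \notin T.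
  apply/negP => i1234.
  have eT : T = [set p in map (perm_word 4)
      [:: [:: 1; 2; 3; 4]; [:: 1; 4; 3; 2]; [:: 3; 2; 1; 4]; y]].
    apply: perm_words_eq => //; last by rewrite /= i1234 i1432 i3214 yT.
    by move: yL; rewrite !inE => /or3P[] /eqP->.
  move: yL; rewrite !inE => /or3P[] /eqP ey;
    [case: T_neq3421 | case: T_neq4231 | case: T_neq4312];
    by rewrite eT ey; apply/setP => p; rewrite !inE !orbA.
(* 1432, 3214 and [y] fill three of the four places in [T], so two further words cannot both belong
   to it. *)
have missing l1 l2 :
    S4_words [:: [:: 1; 4; 3; 2]; [:: 3; 2; 1; 4]; y; l1; l2] ->
    perm_word 4 l1 \notin T \/ perm_word 4 l2 \notin T.
  move=> SL.
  have [|l] := @exists_perm_word_notin T _ SL; first by rewrite cardT.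
  rewrite !inE => /or4P[/eqP->|/eqP->|/eqP->|/orP[]/eqP->];
    by rewrite ?i1432 ?i3214 ?yT; auto.
have cG : shift_perm m \in G.
  have [||nl] := missing [:: 2; 3; 4; 1] [:: 4; 1; 2; 3].
  - by move: yL; rewrite !inE => /or3P[] /eqP->.
  - by move=> nl; apply/mG/shift_avoider; rewrite /misses /= n1234 nl.
  - by rewrite -groupV; apply/mG/shiftV_avoider; rewrite /misses /= n1234 nl.
have top_1243 : perm_word 4 [:: 1; 2; 4; 3] \notin T ->
    G = [set: 'S_m.+2] :> {set _}.
  move=> nl; apply: top_full => //.
  by apply/mG/top_avoider; rewrite /misses /= n1234 nl.
(* The words tested next must differ from [y]: 4312 is paired with 1243 if [y] is 3421, and 3421
   with 1243 otherwise. *)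
have [y3421|ny3421] := eqVneq y [:: 3; 4; 2; 1].
  have [||nl] := missing [:: 4; 3; 1; 2] [:: 1; 2; 4; 3].
    by rewrite y3421.
    by move=> nl; apply/bot_full/botG.
  exact: top_1243.
have [||nl] := missing [:: 3; 4; 2; 1] [:: 1; 2; 4; 3].
- by move: yL; rewrite !inE (negPf ny3421) /= => /orP[] /eqP->.
- by move=> nl; apply/top_full/topG.
- exact: top_1243.
Qed.
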